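(* Let $\mathbf H=(\underline H,\overline H,\omega)$ be a weak (monad-comonad) entwining on a Cauchy complete category $\mathbb A$ and $\mathbf G$ the comonad it induces on $\mathbb A_{\underline H}$. Then there is an isomorphism of categories $$\Phi:\mathbb A^{\overline H}_{\underline H}(\omega)\to(\mathbb A_{\underline H})^{\mathbf G},\qquad (a,h,\theta)\mapsto\big((a,h),\,p_{(a,h)}\cdot\theta\big),$$ with inverse given by $\Phi^{-1}((a,h),\zeta)=(a,h,\,i_{(a,h)}\cdot\zeta)$.
   Context: $\cdot$ is vertical composition of natural transformations and juxtaposition is composition of functors and whiskering. Cauchy complete means every idempotent splits. $\mathbb A_{\underline H}$, $\mathbb A^{\overline H}$ are the Eilenberg–Moore categories of modules of the monad $\underline H$ and comodules of the comonad $\overline H$; $(\mathbb A_{\underline H})^{\mathbf G}$ is the category of $\mathbf G$-comodules in $\mathbb A_{\underline H}$. Weak entwining. Let $\underline H=(H,m,e)$ be a monad and $\overline H=(H,\delta,\varepsilon)$ a comonad on $\mathbb A$ with the same endofunctor $H$. For $\omega:HH\to HH$ put $\xi:=\varepsilon H\cdot\omega\cdot eH:H\to H$. $(\underline H,\overline H,\omega)$ is a weak entwining if (i) $\omega\cdot mH=Hm\cdot\omega H\cdot H\omega$ and $\delta H\cdot\omega=H\omega\cdot\omega H\cdot H\delta$; (ii) $\omega\cdot eH=H\xi\cdot\delta$ and $\varepsilon H\cdot\omega=m\cdot H\xi$. Mixed bimodules. $\mathbb A^{\overline H}_{\underline H}(\omega)$ has as objects triples $(a,h,\theta)$ with $(a,h)\in\mathbb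 A_{\underline H}$, $(a,\theta)\in\mathbb A^{\overline H}$ and $\theta\cdot h=H(h)\cdot\omega_a\cdot H(\theta)$; morphisms are morphisms of $\mathbb A$ that are both $\underline H$-module and $\overline H$-comodule morphisms. Induced comonad $\mathbf G$. For $(a,h)\in\mathbb A_{\underline H}$ the morphism $\Gamma_{(a,h)}:=H(h)\cdot\omega_a\cdot e_{H(a)}:H(a)\to H(a)$ is a natural idempotent; let $\Gamma=i\cdot p$, $p\cdot i=1$, with $p_{(a,h)}:H(a)\to G(a,h)$, $i_{(a,h)}:G(a,h)\to H(a)$, be a splitting. The functor part of $\mathbf G$ sends $(a,h)$ to $G(a,h)$ with module structure $p_{(a,h)}\cdot H(h)\cdot\omega_a\cdot H(i_{(a,h)}):HG(a,h)\to G(a,h)$; its comultiplication is $G(a,h)\xrightarrow{i_{(a,h)}}H(a)\xrightarrow{\delta_a}HH(a)\xrightarrow{H(p_{(a,h)})}HG(a,h)\xrightarrow{p_{G(a,h)}}GG(a,h)$ and its counit is $h\cdot i_{(a,h)}:G(a,h)\to a$.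
   Formalization: The counit of the induced comonad G is taken to be ε_a·i_{(a,h)} instead of the printed h·i_{(a,h)}, which in general violates the counit law (e.g. H = M×− for a nontrivial group M); the counit is uniquely determined by the comultiplication, so no case is lost. *)

(* Defs.v *)
From Stdlib Require Import ssreflect ProofIrrelevance IndefiniteDescription.

Set Implicit Arguments.
Unset Strict Implicit.
Unset Printing Implicit Defensive.
Set Primitive Projections.

Declare Scope cat_scope.
Delimit Scope cat_scope with cat.
Local Open Scope cat_scope.

(** * Categories, functors, natural transformations *)

Record Category := {
  obj :> Type;
  hom : obj -> obj -> Type;
  idm : forall a, hom a a;
  comp : forall a b c, hom b c -> hom a b -> hom a c;
  comp_id_l : forall a b (f : hom a b), comp (idm b) f = f;
  comp_id_r : forall a b (f : hom a b), comp f (idm a) = f;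
  comp_assoc : forall a b c d (h : hom c d) (g : hom b c) (f : hom a b),
    comp (comp h g) f = comp h (comp g f)
}.
Arguments hom {_} _ _.
Arguments idm {_} _.
Arguments comp {_ _ _ _} _ _.

Notation "g ∘ f" := (comp g f) (at level 38, right associativity) : cat_scope.

Record Functor (A B : Category) := {
  fob :> A -> B;
  fmap : forall a b, hom a b -> hom (fob a) (fob b);
  fmap_id : forall a, fmap (idm a) = idm (fob a);
  fmap_comp : forall a b c (g : hom b c) (f : hom a b),
    fmap (g ∘ f) = fmap g ∘ fmap f
}.
Arguments fmap {_ _} _ {_ _} _.

Definition fid (A : Category) : Functor A A :=
  @Build_Functor A A (fun a => a) (fun a b f => f)
    (fun a => eq_refl) (fun a b c g f => eq_refl).

Program Definition fcomp (A B C : Category) (G : Functor B C) (F : Functor A B) :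
    Functor A C :=
  {| fob := fun a => G (F a);
     fmap := fun a b f => fmap G (fmap F f) |}.
Next Obligation. by rewrite !fmap_id. Qed.
Next Obligation. by rewrite !fmap_comp. Qed.

Record NatTrans (A B : Category) (F G : Functor A B) := {
  nt :> forall a, hom (F a) (G a);
  naturality : forall a b (f : hom a b), fmap G f ∘ nt a = nt b ∘ fmap F f
}.

(** [Ps] is a strict two-sided inverse of [Ph]; the equalities are Leibniz
    equalities of functors, hence cover objects and morphisms. *)
Definition mutually_inverse (A B : Category) (Ph : Functor A B) (Ps : Functor B A) :=
  fcomp Ps Ph = fid A /\ fcomp Ph Ps = fid B.

(** * Idempotents *)

Record Splitting (A : Category) (a : A) (e : hom a a) := {
  split_ob : A;
  split_p : hom a split_ob;
  split_i : hom split_ob a;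
  split_ip : split_i ∘ split_p = e;
  split_pi : split_p ∘ split_i = idm split_ob
}.

Definition cauchy_complete (A : Category) :=
  forall (a : A) (e : hom a a), e ∘ e = e -> inhabited (Splitting e).

(** * Monads and comonads on a given endofunctor *)

Record MonadOn (A : Category) (H : Functor A A) := {
  mul : NatTrans (fcomp H H) H;
  munit : NatTrans (fid A) H;
  mul_assoc : forall a, mul a ∘ mul (H a) = mul a ∘ fmap H (mul a);
  mul_unit_l : forall a, mul a ∘ munit (H a) = idm (H a);
  mul_unit_r : forall a, mul a ∘ fmap H (munit a) = idm (H a)
}.

Record ComonadOn (A : Category) (H : Functor A A) := {
  comul : NatTrans H (fcomp H H);
  counit : NatTrans H (fid A);
  comul_assoc : forall a, comul (H a) ∘ comul a = fmap H (comul a) ∘ comul a;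
  comul_counit_l : forall a, counit (H a) ∘ comul a = idm (H a);
  comul_counit_r : forall a, fmap H (counit a) ∘ comul a = idm (H a)
}.

Lemma counit_unique (A : Category) (G : Functor A A) (D D' : ComonadOn G) :
  (forall a, comul D a = comul D' a) -> forall a, counit D a = counit D' a.
Proof.
  move=> E a.
  have N : counit D' a ∘ counit D (G a) = counit D a ∘ fmap G (counit D' a).
    exact: (naturality (counit D) (counit D' a)).
  have R : fmap G (counit D' a) ∘ comul D a = idm (G a).
    by rewrite E comul_counit_r.
  rewrite -[LHS]comp_id_r -R -comp_assoc -N comp_assoc comul_counit_l.
  exact: comp_id_r.
Qed.

(** * Eilenberg-Moore categories *)

Section Modules.
Context {A : Category} {H : Functor A A} (T : MonadOn H).

Record is_module (a : A) (h : hom (H a) a) : Prop := {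
  act_unit : h ∘ munit T a = idm a;
  act_assoc : h ∘ mul T a = h ∘ fmap H h
}.

Definition is_module_mor (a b : A) (h : hom (H a) a) (k : hom (H b) b)
    (f : hom a b) : Prop :=
  f ∘ h = k ∘ fmap H f.

Record Module := {
  mcar :> A;
  mact : hom (H mcar) mcar;
  mact_is_module : is_module mact
}.

Record ModuleMor (X Y : Module) := {
  mmor :> hom X Y;
  mmor_is_mor : is_module_mor (mact X) (mact Y) mmor
}.

Lemma module_mor_eq (X Y : Module) (f g : ModuleMor X Y) :
  mmor f = mmor g -> f = g.
Proof.
  case: f g => [f pf] [g pg] /= E; subst g.
  by rewrite (proof_irrelevance _ pf pg).
Qed.

Program Definition EM : Category := {|
  obj := Module;
  hom := ModuleMor;
  idm := fun X => {| mmor := idm (mcar X) |};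
  comp := fun X Y Z g f => {| mmor := mmor g ∘ mmor f |}
|}.
Next Obligation. by rewrite /is_module_mor fmap_id comp_id_l comp_id_r. Qed.
Next Obligation.
  rewrite /is_module_mor fmap_comp comp_assoc (mmor_is_mor f).
  by rewrite -!comp_assoc (mmor_is_mor g).
Qed.
Next Obligation. by apply: module_mor_eq; rewrite /= comp_id_l. Qed.
Next Obligation. by apply: module_mor_eq; rewrite /= comp_id_r. Qed.
Next Obligation. by apply: module_mor_eq; rewrite /= comp_assoc. Qed.
End Modules.

Section Comodules.
Context {A : Category} {H : Functor A A} (C : ComonadOn H).

Record is_comodule (a : A) (t : hom a (H a)) : Prop := {
  coact_counit : counit C a ∘ t = idm a;
  coact_coassoc : comul C a ∘ t = fmap H t ∘ t
}.

Definition is_comodule_mor (a b : A) (t : hom a (H a)) (u : hom b (H b))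
    (f : hom a b) : Prop :=
  fmap H f ∘ t = u ∘ f.

Record Comodule := {
  ccar :> A;
  cact : hom ccar (H ccar);
  cact_is_comodule : is_comodule cact
}.

Record ComoduleMor (X Y : Comodule) := {
  cmor :> hom X Y;
  cmor_is_mor : is_comodule_mor (cact X) (cact Y) cmor
}.

Lemma comodule_mor_eq (X Y : Comodule) (f g : ComoduleMor X Y) :
  cmor f = cmor g -> f = g.
Proof.
  case: f g => [f pf] [g pg] /= E; subst g.
  by rewrite (proof_irrelevance _ pf pg).
Qed.

Program Definition coEM : Category := {|
  obj := Comodule;
  hom := ComoduleMor;
  idm := fun X => {| cmor := idm (ccar X) |};
  comp := fun X Y Z g f => {| cmor := cmor g ∘ cmor f |}
|}.
Next Obligation. by rewrite /is_comodule_mor fmap_id comp_id_l comp_id_r. Qed.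
Next Obligation.
  rewrite /is_comodule_mor fmap_comp comp_assoc (cmor_is_mor f).
  by rewrite -!comp_assoc (cmor_is_mor g).
Qed.
Next Obligation. by apply: comodule_mor_eq; rewrite /= comp_id_l. Qed.
Next Obligation. by apply: comodule_mor_eq; rewrite /= comp_id_r. Qed.
Next Obligation. by apply: comodule_mor_eq; rewrite /= comp_assoc. Qed.

Definition coEM_forget : Functor coEM A :=
  @Build_Functor coEM A ccar (fun X Y f => cmor f)
    (fun X => eq_refl) (fun X Y Z g f => eq_refl).
End Comodules.

(** * Weak entwinings *)

Section WeakEntwining.
Context {A : Category} {H : Functor A A} (T : MonadOn H) (C : ComonadOn H).
Context (w : NatTrans (fcomp H H) (fcomp H H)).

Definition xi (a : A) : hom (H a) (H a) :=
  counit C (H a) ∘ w a ∘ munit T (H a).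

Record weak_entwining : Prop := {
  we_mul : forall a,
    w a ∘ mul T (H a) = fmap H (mul T a) ∘ w (H a) ∘ fmap H (w a);
  we_comul : forall a,
    comul C (H a) ∘ w a = fmap H (w a) ∘ w (H a) ∘ fmap H (comul C a);
  we_unit : forall a,
    w a ∘ munit T (H a) = fmap H (xi a) ∘ comul C a;
  we_counit : forall a,
    counit C (H a) ∘ w a = mul T a ∘ fmap H (xi a)
}.

Definition is_mixed (a : A) (h : hom (H a) a) (t : hom a (H a)) : Prop :=
  t ∘ h = fmap H h ∘ w a ∘ fmap H t.

Record Bimodule := {
  bcar : A;
  bact : hom (H bcar) bcar;
  bcoact : hom bcar (H bcar);
  bact_is_module : is_module T bact;
  bcoact_is_comodule : is_comodule C bcoact;
  b_is_mixed : is_mixed bact bcoact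
}.

Record BimoduleMor (X Y : Bimodule) := {
  bmor : hom (bcar X) (bcar Y);
  bmor_is_module_mor : is_module_mor (bact X) (bact Y) bmor;
  bmor_is_comodule_mor : is_comodule_mor (bcoact X) (bcoact Y) bmor
}.

Lemma bimodule_mor_eq (X Y : Bimodule) (f g : BimoduleMor X Y) :
  bmor f = bmor g -> f = g.
Proof.
  case: f g => [f pf qf] [g pg qg] /= E; subst g.
  by rewrite (proof_irrelevance _ pf pg) (proof_irrelevance _ qf qg).
Qed.

Program Definition MixedBimod : Category := {|
  obj := Bimodule;
  hom := BimoduleMor;
  idm := fun X => {| bmor := idm (bcar X) |};
  comp := fun X Y Z g f => {| bmor := bmor g ∘ bmor f |}
|}.
Next Obligation. by rewrite /is_module_mor fmap_id comp_id_l comp_id_r. Qed.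
Next Obligation. by rewrite /is_comodule_mor fmap_id comp_id_l comp_id_r. Qed.
Next Obligation.
  rewrite /is_module_mor fmap_comp comp_assoc (bmor_is_module_mor f).
  by rewrite -!comp_assoc (bmor_is_module_mor g).
Qed.
Next Obligation.
  rewrite /is_comodule_mor fmap_comp comp_assoc (bmor_is_comodule_mor f).
  by rewrite -!comp_assoc (bmor_is_comodule_mor g).
Qed.
Next Obligation. by apply: bimodule_mor_eq; rewrite /= comp_id_l. Qed.
Next Obligation. by apply: bimodule_mor_eq; rewrite /= comp_id_r. Qed.
Next Obligation. by apply: bimodule_mor_eq; rewrite /= comp_assoc. Qed.

Definition bim_module (X : Bimodule) : EM T :=
  {| mcar := bcar X; mact := bact X; mact_is_module := bact_is_module X |}.

Program Definition bim_forget : Functor MixedBimod (EM T) := {|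
  fob := bim_module;
  fmap := fun X Y f => @Build_ModuleMor A H T (bim_module X) (bim_module Y)
                         (bmor f) (bmor_is_module_mor f)
|}.
Next Obligation. exact: module_mor_eq. Qed.
Next Obligation. exact: module_mor_eq. Qed.

(** * The induced comonad *)

Definition Gamma (X : EM T) : hom (H (mcar X)) (H (mcar X)) :=
  fmap H (mact X) ∘ w (mcar X) ∘ munit T (H (mcar X)).

(** [Gamma] before precomposition with the unit; locked so that rewriting does
    not see the composite inside. *)
Definition lact (X : EM T) : hom (H (H (mcar X))) (H (mcar X)) :=
  locked (fmap H (mact X) ∘ w (mcar X)).

End WeakEntwining.

Section Induced.
Context {A : Category} {H : Functor A A} {T : MonadOn H} {C : ComonadOn H}.
Context {w : NatTrans (fcomp H H) (fcomp H H)} (hw : weak_entwining T C w).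

Local Notation "'Γ' X" := (Gamma w X) (at level 9, X at level 8).
Local Notation K X := (lact w X).
Local Notation e := (munit T).
Local Notation m := (mul T).
Local Notation δ := (comul C).
Local Notation ε := (counit C).

Lemma hd (B : Category) (a b c d : B) (g : hom b c) (f : hom a b) (k : hom a c)
    (x : hom d a) : g ∘ f = k -> g ∘ f ∘ x = k ∘ x.
Proof. by move=> <-; rewrite comp_assoc. Qed.

Lemma hd3 (B : Category) (a b c c' d d' : B) (h : hom c d) (g : hom b c)
    (f : hom a b) (k : hom c' d) (l : hom a c') (x : hom d' a) :
  h ∘ g ∘ f = k ∘ l -> h ∘ g ∘ f ∘ x = k ∘ l ∘ x.
Proof. by move=> E; rewrite -!comp_assoc (comp_assoc h) E. Qed.

Lemma hd2 (B : Category) (a b b' c d : B) (g : hom b c) (f : hom a b)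
    (g' : hom b' c) (f' : hom a b') (x : hom d a) :
  g ∘ f = g' ∘ f' -> g ∘ f ∘ x = g' ∘ f' ∘ x.
Proof. by move=> E; rewrite -!comp_assoc E. Qed.

Lemma unit_nat (a b : A) (f : hom a b) : fmap H f ∘ e a = e b ∘ f.
Proof. exact: (naturality e f). Qed.
Lemma mul_nat (a b : A) (f : hom a b) : fmap H f ∘ m a = m b ∘ fmap H (fmap H f).
Proof. exact: (naturality m f). Qed.
Lemma comul_nat (a b : A) (f : hom a b) : fmap H (fmap H f) ∘ δ a = δ b ∘ fmap H f.
Proof. exact: (naturality δ f). Qed.
Lemma counit_nat (a b : A) (f : hom a b) : f ∘ ε a = ε b ∘ fmap H f.
Proof. exact: (naturality ε f). Qed.
Lemma w_nat (a b : A) (f : hom a b) :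
  fmap H (fmap H f) ∘ w a = w b ∘ fmap H (fmap H f).
Proof. exact: (naturality w f). Qed.

Lemma GammaD (X : EM T) : Γ X = fmap H (mact X) ∘ w (mcar X) ∘ e (H (mcar X)).
Proof. by []. Qed.
Lemma lactD (X : EM T) : K X = fmap H (mact X) ∘ w (mcar X).
Proof. by rewrite /lact -lock. Qed.

Lemma GammaE (X : EM T) : Γ X = K X ∘ e (H (mcar X)).
Proof. by rewrite GammaD lactD comp_assoc. Qed.

Lemma lact_assoc (X : EM T) : K X ∘ m (H (mcar X)) = K X ∘ fmap H (K X).
Proof.
  rewrite !lactD comp_assoc (we_mul hw) -comp_assoc -fmap_comp.
  rewrite (act_assoc (mact_is_module X)) !fmap_comp !comp_assoc.
  by rewrite (hd2 _ (w_nat _)).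
Qed.

Lemma lact_nat (X Y : EM T) (f : hom X Y) :
  fmap H (mmor f) ∘ K X = K Y ∘ fmap H (fmap H (mmor f)).
Proof.
  rewrite !lactD -comp_assoc -fmap_comp (mmor_is_mor f) fmap_comp !comp_assoc.
  by rewrite w_nat.
Qed.

Lemma Gamma_lact (X : EM T) : Γ X ∘ K X = K X.
Proof.
  rewrite GammaE comp_assoc -unit_nat -comp_assoc -lact_assoc comp_assoc.
  by rewrite mul_unit_l comp_id_r.
Qed.

Lemma lact_Gamma (X : EM T) : K X ∘ fmap H (Γ X) = K X.
Proof.
  rewrite GammaE fmap_comp -comp_assoc -lact_assoc comp_assoc.
  by rewrite mul_unit_r comp_id_r.
Qed.

Lemma Gamma_idem (X : EM T) : Γ X ∘ Γ X = Γ X.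
Proof. by rewrite {2 3}GammaE -comp_assoc Gamma_lact. Qed.

Lemma Gamma_nat (X Y : EM T) (f : hom X Y) :
  fmap H (mmor f) ∘ Γ X = Γ Y ∘ fmap H (mmor f).
Proof. by rewrite !GammaE -comp_assoc lact_nat !comp_assoc unit_nat. Qed.

(** The induced comonad depends on a choice of splittings of [Gamma], here an
    arbitrary family [S]; Cauchy completeness guarantees that one exists. *)
Lemma Gamma_splittings : cauchy_complete A ->
  inhabited (forall X : EM T, Splitting (Γ X)).
Proof.
  move=> cc; constructor=> X.
  case: (constructive_indefinite_description (fun _ : Splitting (Γ X) => True)) => //.
  by case: (cc _ _ (Gamma_idem X)) => s; exists s.
Qed.

Lemma counit_Gamma (X : EM T) : ε (mcar X) ∘ Γ X = mact X ∘ xi T C w (mcar X).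
Proof. by rewrite !GammaD /xi -comp_assoc -counit_nat !comp_assoc. Qed.

Lemma comul_Gamma (X : EM T) :
  δ (mcar X) ∘ Γ X = fmap H (K X) ∘ w (H (mcar X)) ∘ e (H (H (mcar X))) ∘ δ (mcar X).
Proof.
  rewrite !GammaD -comp_assoc -comul_nat comp_assoc (hd _ (we_comul hw _)).
  rewrite !comp_assoc unit_nat !lactD fmap_comp !comp_assoc.
  done.
Qed.

Lemma comul_lact (X : EM T) :
  δ (mcar X) ∘ K X = fmap H (K X) ∘ w (H (mcar X)) ∘ fmap H (δ (mcar X)).
Proof.
  by rewrite !lactD -comp_assoc -comul_nat comp_assoc (we_comul hw) fmap_comp !comp_assoc.
Qed.

Context (S : forall X : EM T, Splitting (Γ X)).

Local Notation GX X := (split_ob (S X)).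
Local Notation p X := (split_p (S X)).
Local Notation i X := (split_i (S X)).

Lemma Gamma_i X : Γ X ∘ i X = i X.
Proof. by rewrite -(split_ip (S X)) comp_assoc split_pi comp_id_r. Qed.
Lemma p_Gamma X : p X ∘ Γ X = p X.
Proof. by rewrite -(split_ip (S X)) -comp_assoc split_pi comp_id_l. Qed.

Definition G_act (X : EM T) : hom (H (GX X)) (GX X) :=
  p X ∘ fmap H (mact X) ∘ w (mcar X) ∘ fmap H (i X).

Lemma G_actE X : G_act X = p X ∘ K X ∘ fmap H (i X).
Proof. by rewrite /G_act !lactD !comp_assoc. Qed.

Lemma i_G_act X : i X ∘ G_act X = K X ∘ fmap H (i X).
Proof. by rewrite G_actE (hd _ (split_ip _)) (hd _ (Gamma_lact X)). Qed.

Lemma Hi_HG_act X :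
  fmap H (i X) ∘ fmap H (G_act X) = fmap H (K X) ∘ fmap H (fmap H (i X)).
Proof. by rewrite -!fmap_comp i_G_act. Qed.

Lemma G_act_is_module (X : EM T) : is_module T (G_act X).
Proof.
  split.
    rewrite G_actE !comp_assoc unit_nat.
    rewrite (hd _ (eq_sym (GammaE X))).
    by rewrite Gamma_i split_pi.
  rewrite {2}G_actE !comp_assoc -fmap_comp i_G_act fmap_comp.
  rewrite (hd2 _ (eq_sym (lact_assoc X))) -mul_nat.
  by rewrite lactD !comp_assoc.
Qed.

Definition G_ob (X : EM T) : EM T :=
  {| mcar := GX X; mact := G_act X; mact_is_module := G_act_is_module X |}.

Definition G_map (X Y : EM T) (f : hom X Y) : hom (GX X) (GX Y) :=
  p Y ∘ fmap H (mmor f) ∘ i X.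

Lemma i_G_map X Y (f : hom X Y) : i Y ∘ G_map f = fmap H (mmor f) ∘ i X.
Proof.
  by rewrite /G_map (hd _ (split_ip _)) -(hd2 _ (Gamma_nat f)) Gamma_i.
Qed.

Lemma i_mono X (a : A) (f g : hom a (GX X)) : i X ∘ f = i X ∘ g -> f = g.
Proof.
  move=> E; rewrite -(comp_id_l f) -(comp_id_l g) -(split_pi (S X)).
  by rewrite !comp_assoc E.
Qed.

Lemma Hi_mono X (a : A) (f g : hom a (H (GX X))) :
  fmap H (i X) ∘ f = fmap H (i X) ∘ g -> f = g.
Proof.
  move=> E; rewrite -(comp_id_l f) -(comp_id_l g) -fmap_id -(split_pi (S X)).
  by rewrite fmap_comp !comp_assoc E.
Qed.

Lemma HHi_mono X (a : A) (f g : hom a (H (H (GX X)))) :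
  fmap H (fmap H (i X)) ∘ f = fmap H (fmap H (i X)) ∘ g -> f = g.
Proof.
  move=> E; rewrite -(comp_id_l f) -(comp_id_l g) -!fmap_id -(split_pi (S X)).
  by rewrite !fmap_comp !comp_assoc E.
Qed.

Lemma G_map_is_mor (X Y : EM T) (f : hom X Y) :
  is_module_mor (G_act X) (G_act Y) (G_map f).
Proof.
  apply: i_mono; rewrite (hd2 _ (i_G_map f)) i_G_act (hd2 _ (i_G_act _)).
  by rewrite (hd2 _ (lact_nat f)) -!fmap_comp i_G_map.
Qed.

Definition G_comul_mor (X : EM T) : hom (GX X) (GX (G_ob X)) :=
  p (G_ob X) ∘ fmap H (p X) ∘ δ (mcar X) ∘ i X.

Lemma Hi_Gamma_Hp (X : EM T) :
  fmap H (i X) ∘ Γ (G_ob X) ∘ fmap H (p X)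
  = fmap H (K X) ∘ w (H (mcar X)) ∘ e (H (H (mcar X))).
Proof.
  rewrite GammaD /= !comp_assoc (hd2 _ (Hi_HG_act X)).
  rewrite (hd2 _ (w_nat _)) (hd2 _ (unit_nat _)) -fmap_comp split_ip.
  rewrite -unit_nat -(hd2 _ (w_nat _)) -comp_assoc.
  by rewrite -fmap_comp lact_Gamma.
Qed.

Lemma i_G_comul X :
  fmap H (i X) ∘ i (G_ob X) ∘ G_comul_mor X = δ (mcar X) ∘ i X.
Proof.
  rewrite /G_comul_mor (hd _ (split_ip _)) -{3}(Gamma_i X) (hd _ (comul_Gamma X)).
  by rewrite -(comp_assoc (Γ _)) -(comp_assoc (fmap H (i X))) Hi_Gamma_Hp !comp_assoc.
Qed.

Lemma i_G_comul_comp X (a : A) (x : hom a (GX X)) :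
  fmap H (i X) ∘ i (G_ob X) ∘ G_comul_mor X ∘ x = δ (mcar X) ∘ i X ∘ x.
Proof. exact: hd3 (i_G_comul X). Qed.

Lemma G_comul_is_mor (X : EM T) :
  is_module_mor (G_act X) (G_act (G_ob X)) (G_comul_mor X).
Proof.
  apply: i_mono; apply: Hi_mono.
  rewrite i_G_comul_comp i_G_act (hd _ (comul_lact X)) (hd2 _ (i_G_act _)).
  rewrite (lactD (G_ob X)) /= !comp_assoc (hd2 _ (Hi_HG_act X)).
  rewrite (hd2 _ (w_nat _)) -!fmap_comp.
  by rewrite i_G_comul.
Qed.

(** The counit is [counit C] restricted along [i].  The composite
    [mact X ∘ i X] with the action cannot be used instead: the counit law forces
    [counit C] ([G_counit_unique]), and the two differ already on sets for
    [H a = M * a], [M] a nontrivial group, with the diagonal comultiplication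
    and [w (x, y, a) = (x y, x, a)]. *)
Definition G_counit_mor (X : EM T) : hom (GX X) (mcar X) := ε (mcar X) ∘ i X.

Lemma G_counit_is_mor (X : EM T) :
  is_module_mor (G_act X) (mact X) (G_counit_mor X).
Proof.
  rewrite /is_module_mor /G_counit_mor comp_assoc i_G_act !lactD comp_assoc.
  rewrite -(hd2 _ (counit_nat _)) (hd _ (we_counit hw _)) comp_assoc.
  rewrite (hd2 _ (act_assoc (mact_is_module X))) -!fmap_comp.
  by rewrite -[in RHS](Gamma_i X) (hd _ (counit_Gamma X)) -(comp_assoc (mact X)).
Qed.

Definition G_mor (X Y : EM T) (f : hom X Y) : hom (G_ob X) (G_ob Y) :=
  @Build_ModuleMor A H T (G_ob X) (G_ob Y) (G_map f) (G_map_is_mor f).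

Definition G_comul_at (X : EM T) : hom (G_ob X) (G_ob (G_ob X)) :=
  @Build_ModuleMor A H T (G_ob X) (G_ob (G_ob X)) (G_comul_mor X) (G_comul_is_mor X).

Definition G_counit_at (X : EM T) : hom (G_ob X) X :=
  @Build_ModuleMor A H T (G_ob X) X (G_counit_mor X) (G_counit_is_mor X).

Lemma G_comul_nat (X Y : EM T) (f : hom X Y) :
  G_map (G_mor f) ∘ G_comul_mor X = G_comul_mor Y ∘ G_map f.
Proof.
  apply: i_mono; apply: Hi_mono.
  rewrite i_G_comul_comp i_G_map (hd2 _ (i_G_map (G_mor f))) /=.
  rewrite -comp_assoc -fmap_comp i_G_map fmap_comp comp_assoc i_G_comul.
  by rewrite (hd2 _ (comul_nat _)).
Qed.

Lemma G_counit_nat (X Y : EM T) (f : hom X Y) :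
  mmor f ∘ G_counit_mor X = G_counit_mor Y ∘ G_map f.
Proof.
  by rewrite /G_counit_mor (hd2 _ (counit_nat _)) comp_assoc i_G_map.
Qed.

Lemma G_comul_assoc (X : EM T) :
  G_comul_mor (G_ob X) ∘ G_comul_mor X = G_map (G_comul_at X) ∘ G_comul_mor X.
Proof.
  apply: i_mono; apply: Hi_mono; rewrite i_G_comul_comp.
  rewrite (hd2 _ (i_G_map (G_comul_at X))) /=.
  apply: HHi_mono.
  rewrite (hd2 _ (comul_nat _)) i_G_comul.
  rewrite (hd3 _ (_ : _ = fmap H (δ (mcar X)) ∘ fmap H (i X))).
    by rewrite -!fmap_comp i_G_comul.
  by rewrite i_G_comul (hd2 _ (comul_assoc C _)).
Qed.

Lemma G_comul_counit_l (X : EM T) :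
  G_counit_mor (G_ob X) ∘ G_comul_mor X = idm (GX X).
Proof.
  apply: i_mono; rewrite /G_counit_mor comp_assoc (hd2 _ (counit_nat _)) i_G_comul.
  by rewrite (hd _ (comul_counit_l C _)) comp_id_l comp_id_r.
Qed.

Lemma G_comul_counit_r (X : EM T) :
  G_map (G_counit_at X) ∘ G_comul_mor X = idm (GX X).
Proof.
  apply: i_mono; rewrite (hd2 _ (i_G_map (G_counit_at X))) /= /G_counit_mor.
  rewrite fmap_comp comp_assoc i_G_comul.
  by rewrite (hd _ (comul_counit_r C _)) comp_id_l comp_id_r.
Qed.

Program Definition G_fun : Functor (EM T) (EM T) := {| fob := G_ob; fmap := G_mor |}.
Next Obligation.
  apply: module_mor_eq; rewrite /= /G_map /= fmap_id comp_id_l.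
  exact: split_pi.
Qed.
Next Obligation.
  apply: module_mor_eq; apply: i_mono.
  rewrite i_G_map /= (hd2 _ (i_G_map _)) i_G_map fmap_comp.
  by rewrite !comp_assoc.
Qed.

Program Definition G_comul : NatTrans G_fun (fcomp G_fun G_fun) := {| nt := G_comul_at |}.
Next Obligation. by apply: module_mor_eq; exact: G_comul_nat. Qed.

Program Definition G_counit : NatTrans G_fun (fid (EM T)) := {| nt := G_counit_at |}.
Next Obligation. by apply: module_mor_eq; exact: G_counit_nat. Qed.

Program Definition G_comonad : ComonadOn G_fun := {| comul := G_comul; counit := G_counit |}.
Next Obligation. by apply: module_mor_eq; exact: G_comul_assoc. Qed.
Next Obligation. by apply: module_mor_eq; exact: G_comul_counit_l. Qed.
Next Obligation. by apply: module_mor_eq; exact: G_comul_counit_r. Qed.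

Lemma G_counit_unique (D : ComonadOn G_fun) :
  (forall X, comul D X = G_comul X) -> forall X, counit D X = G_counit X.
Proof. exact: (counit_unique (D' := G_comonad)). Qed.

End Induced.

(* Main.v *)
(** The mixed condition and unitality of [h] give
    [Γ·θ = H h·ω·H θ·e = θ·h·e = θ], so a mixed coaction [θ : a -> H a] factors
    through the splitting of [Γ], and [θ ↦ p·θ], [ζ ↦ i·ζ] are mutually inverse.
    Since [i] and [H i·i] are split monic, the conditions on [p·θ] and on
    morphisms reduce to those for [θ]. *)

From Stdlib Require Import ssreflect ProofIrrelevance FunctionalExtensionality Eqdep.
Require Import Defs.
Local Open Scope cat_scope.

Set Implicit Arguments.
Unset Strict Implicit.
Unset Printing Implicit Defensive.

(** The type of the morphism map depends on the object map, so the two are compared as one dependent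
    pair; the functor laws then agree by proof irrelevance. *)
Lemma functor_data_eq (A B : Category) (F G : Functor A B) :
  existT (fun o : A -> B => forall a b, hom a b -> hom (o a) (o b))
    (fob F) (@fmap _ _ F)
  = existT (fun o : A -> B => forall a b, hom a b -> hom (o a) (o b))
    (fob G) (@fmap _ _ G) ->
  F = G.
Proof.
  case: F G => [fo fm fi fc] [go gm gi gc] /= E.
  move: gi gc; have Eo : fo = go by exact: (f_equal (@projT1 _ _) E).
  subst go; move: (inj_pair2 _ _ _ _ _ E) => Em; subst gm => gi gc.
  by rewrite (proof_irrelevance _ fi gi) (proof_irrelevance _ fc gc).
Qed.

Definition faithful (B D : Category) (U : Functor B D) :=
  forall (a b : B) (f g : hom a b), fmap U f = fmap U g -> f = g.

(** Comparing morphism maps directly would need a transport along the equalities [F a = G a]. The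
    equation after [U] avoids this: once the object maps are identified, it compares the images
    under [U], and faithfulness cancels [U]. *)
Lemma faithful_functor_eq (A B D : Category) (U : Functor B D) (F G : Functor A B) :
  faithful U -> (forall a, F a = G a) -> fcomp U F = fcomp U G -> F = G.
Proof.
  move=> fU Eo EU; apply: functor_data_eq.
  case: F G Eo EU => [fo fm fi fc] [go gm gi gc] /= Eo EU.
  have E : fo = go by exact: functional_extensionality.
  subst go; congr existT.
  pose data (K : Functor A D) :=
    existT (fun o : A -> D => forall a b, hom a b -> hom (o a) (o b))
      (fob K) (@fmap _ _ K).
  (* With equal object maps, uniqueness of identity proofs lets the second components of the pairs
     be compared without transport. *)
  move: (inj_pair2 _ _ _ _ _ (f_equal data EU)) => /= Em.
  do 3 apply: functional_extensionality_dep => ?; apply: fU.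
  exact: (f_equal (fun k => k _ _ _) Em).
Qed.

Lemma comodule_eq (A : Category) (H : Functor A A) (C : ComonadOn H) (a : A)
    (t u : hom a (H a)) (ht : is_comodule C t) (hu : is_comodule C u) :
  t = u -> Build_Comodule ht = Build_Comodule hu.
Proof. by move=> E; subst u; rewrite (proof_irrelevance _ ht hu). Qed.

Lemma bimodule_eq (A : Category) (H : Functor A A) (T : MonadOn H)
    (C : ComonadOn H) (w : NatTrans (fcomp H H) (fcomp H H)) (a : A)
    (h : hom (H a) a) (t u : hom a (H a)) (hh hh' : is_module T h)
    (ht : is_comodule C t) (hu : is_comodule C u)
    (mt : is_mixed w h t) (mu : is_mixed w h u) :
  t = u -> Build_Bimodule hh ht mt = Build_Bimodule hh' hu mu.
Proof.
  move=> E; subst u; rewrite (proof_irrelevance _ hh hh').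
  by rewrite (proof_irrelevance _ ht hu) (proof_irrelevance _ mt mu).
Qed.

Section MixedBimodulesAsComodules.
Context {A : Category} {H : Functor A A} {T : MonadOn H} {C : ComonadOn H}.
Context {w : NatTrans (fcomp H H) (fcomp H H)} (hw : weak_entwining T C w).
Context (S : forall X : EM T, Splitting (Gamma w X)).

Local Notation p X := (split_p (S X)).
Local Notation i X := (split_i (S X)).
Local Notation G := (G_comonad hw S).

Lemma bim_forget_faithful : faithful (bim_forget T C w).
Proof.
  by move=> X Y f g E; apply: bimodule_mor_eq; exact: (f_equal (@mmor _ _ _ _ _) E).
Qed.

Lemma coEM_forget_faithful (B : Category) (K : Functor B B) (D : ComonadOn K) :
  faithful (coEM_forget D).
Proof. by move=> X Y f g E; apply: comodule_mor_eq. Qed.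

(** The mixed condition in terms of [lact], the form that meets [i_G_act]. *)
Lemma lact_bcoact (X : Bimodule T C w) :
  lact w (bim_module X) ∘ fmap H (bcoact X) = bcoact X ∘ bact X.
Proof. by rewrite lactD comp_assoc (b_is_mixed X). Qed.

Lemma Gamma_bcoact (X : Bimodule T C w) : Gamma w (bim_module X) ∘ bcoact X = bcoact X.
Proof.
  rewrite GammaE comp_assoc -unit_nat -comp_assoc lact_bcoact comp_assoc.
  by rewrite (act_unit (bact_is_module X)) comp_id_r.
Qed.

Lemma i_p_bcoact (X : Bimodule T C w) :
  i (bim_module X) ∘ p (bim_module X) ∘ bcoact X = bcoact X.
Proof. by rewrite (hd _ (split_ip _)) Gamma_bcoact. Qed.

Lemma p_bcoact_is_module_mor (X : Bimodule T C w) :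
  is_module_mor (bact X) (G_act S (bim_module X)) (p (bim_module X) ∘ bcoact X).
Proof.
  (* After cancelling [i], both sides become [θ·h], the right one by the mixed condition. *)
  apply: (i_mono (S := S)).
  rewrite (hd2 _ (i_G_act hw S _)) -fmap_comp i_p_bcoact lact_bcoact.
  by rewrite -[in RHS]i_p_bcoact !comp_assoc.
Qed.

Definition bim_coact (X : Bimodule T C w) : hom (bim_module X) (G_fun hw S (bim_module X)) :=
  @Build_ModuleMor A H T (bim_module X) (G_fun hw S (bim_module X))
    (p (bim_module X) ∘ bcoact X) (p_bcoact_is_module_mor X).

Lemma bim_coact_is_comodule (X : Bimodule T C w) : is_comodule G (bim_coact X).
Proof.
  split; apply: module_mor_eq => /=.
    rewrite /G_counit_mor comp_assoc i_p_bcoact.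
    exact: (coact_counit (bcoact_is_comodule X)).
  (* Under the monic [H i·i] the comultiplication of [G] becomes [δ], which leaves coassociativity
     of [θ]. *)
  apply: (i_mono (S := S)); apply: (Hi_mono (S := S)).
  rewrite (i_G_comul_comp hw) i_p_bcoact.
  rewrite (hd2 _ (i_G_map S (bim_coact X))) i_p_bcoact /=.
  rewrite -comp_assoc -fmap_comp i_p_bcoact.
  exact: (coact_coassoc (bcoact_is_comodule X)).
Qed.

Definition bim_comodule (X : Bimodule T C w) : Comodule G :=
  Build_Comodule (bim_coact_is_comodule X).

Lemma bim_mor_is_comodule_mor (X Y : Bimodule T C w) (f : BimoduleMor X Y) :
  is_comodule_mor (H := G_fun hw S) (bim_coact X) (bim_coact Y) (fmap (bim_forget T C w) f).
Proof.
  (* Under [i] the map [G f] becomes [H f], so what remains is that [f] respects [θ]. *)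
  apply: module_mor_eq; apply: (i_mono (S := S)) => /=.
  rewrite (hd2 _ (i_G_map S (fmap (bim_forget T C w) f))) i_p_bcoact /=.
  rewrite (bmor_is_comodule_mor f) -[in LHS]i_p_bcoact.
  by rewrite !comp_assoc.
Qed.

Program Definition bim_to_comodule : Functor (MixedBimod T C w) (coEM G) := {|
  fob := bim_comodule;
  fmap := fun X Y f => @Build_ComoduleMor _ _ G (bim_comodule X) (bim_comodule Y)
                         (fmap (bim_forget T C w) f) (bim_mor_is_comodule_mor f)
|}.
Next Obligation. by apply: comodule_mor_eq; apply: module_mor_eq. Qed.
Next Obligation. by apply: comodule_mor_eq; apply: module_mor_eq. Qed.

Section CoactionToBimodule.
Context (Z : Comodule G).
Local Notation Z0 := (ccar Z).
Local Notation z := (mmor (cact Z)).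

Lemma i_coact_is_comodule : is_comodule C (i Z0 ∘ z).
Proof.
  split.
    have /= := f_equal (@mmor _ _ _ _ _) (coact_counit (cact_is_comodule Z)).
    by rewrite /G_counit_mor comp_assoc.
  have /= E := f_equal (@mmor _ _ _ _ _) (coact_coassoc (cact_is_comodule Z)).
  (* Expanding [δ·i·z] through the comultiplication of [G] exposes the coassociativity of [z];
     naturality of [i] then yields [H(i·z)·i·z]. *)
  rewrite -(i_G_comul_comp hw) E (hd2 _ (i_G_map S (cact Z))).
  by rewrite fmap_comp !comp_assoc.
Qed.

(** Linearity of [z] with respect to [G_act], carried along [i], is the mixed condition. *)
Lemma i_coact_is_mixed : is_mixed w (mact Z0) (i Z0 ∘ z).
Proof.
  rewrite /is_mixed comp_assoc (mmor_is_mor (cact Z)) /= (hd2 _ (i_G_act hw S _)).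
  by rewrite -fmap_comp lactD comp_assoc.
Qed.

Definition comodule_bim : Bimodule T C w :=
  Build_Bimodule (mact_is_module Z0) i_coact_is_comodule i_coact_is_mixed.

End CoactionToBimodule.

Lemma comodule_mor_is_comodule_mor (Y Z : Comodule G) (f : ComoduleMor Y Z) :
  is_comodule_mor (bcoact (comodule_bim Y)) (bcoact (comodule_bim Z)) (mmor (cmor f)).
Proof.
  have /= E := f_equal (@mmor _ _ _ _ _) (cmor_is_mor f).
  by rewrite /is_comodule_mor /= comp_assoc -E (hd2 _ (i_G_map S (cmor f))).
Qed.

Program Definition comodule_to_bim : Functor (coEM G) (MixedBimod T C w) := {|
  fob := comodule_bim;
  fmap := fun Y Z f => @Build_BimoduleMor A H T C w (comodule_bim Y) (comodule_bim Z)
            (mmor (cmor f)) (mmor_is_mor (cmor f)) (comodule_mor_is_comodule_mor f)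
|}.
Next Obligation. exact: bimodule_mor_eq. Qed.
Next Obligation. exact: bimodule_mor_eq. Qed.

Lemma comodule_bim_bim_comodule (X : Bimodule T C w) : comodule_bim (bim_comodule X) = X.
Proof. apply: bimodule_eq; exact: i_p_bcoact. Qed.

Lemma bim_comodule_comodule_bim (Z : Comodule G) : bim_comodule (comodule_bim Z) = Z.
Proof.
  apply: comodule_eq; apply: module_mor_eq => /=.
  by rewrite (hd _ (split_pi _)) comp_id_l.
Qed.

Lemma forget_bim_to_comodule : fcomp (coEM_forget G) bim_to_comodule = bim_forget T C w.
Proof. exact: functor_data_eq. Qed.

(** The round trips fix objects only propositionally, but they change nothing except the coaction,
    so after forgetting it the composites agree by computation. *)
Lemma bim_to_comodule_inverse : mutually_inverse bim_to_comodule comodule_to_bim.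
Proof.
  split.
    apply: (faithful_functor_eq bim_forget_faithful).
      exact: comodule_bim_bim_comodule.
    exact: functor_data_eq.
  apply: (faithful_functor_eq (@coEM_forget_faithful _ _ G)).
    exact: bim_comodule_comodule_bim.
  exact: functor_data_eq.
Qed.

End MixedBimodulesAsComodules.

(** The last clause determines [Phi] on morphisms, about which the object formulas say nothing. *)
Theorem theorem5p4 (A : Category) (hA : cauchy_complete A) (H : Functor A A)
    (T : MonadOn H) (C : ComonadOn H) (w : NatTrans (fcomp H H) (fcomp H H))
    (hw : weak_entwining T C w)
    (sp : forall X : EM T, Splitting (Gamma w X)) :
  exists (Phi : Functor (MixedBimod T C w) (coEM (G_comonad hw sp)))
         (Psi : Functor (coEM (G_comonad hw sp)) (MixedBimod T C w)),
    mutually_inverse Phi Psi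
    /\ (forall X : Bimodule T C w,
          exists l c,
            Phi X = @Build_Comodule (EM T) (G_fun hw sp) (G_comonad hw sp)
                      (bim_module X)
                      (@Build_ModuleMor A H T (bim_module X)
                         (G_fun hw sp (bim_module X))
                         (split_p (sp (bim_module X)) ∘ bcoact X) l) c)
    /\ (forall Z : Comodule (G_comonad hw sp),
          exists hm hc hx,
            Psi Z = @Build_Bimodule A H T C w
                      (mcar (ccar Z)) (mact (ccar Z))
                      (split_i (sp (ccar Z)) ∘ mmor (cact Z)) hm hc hx)
    /\ fcomp (coEM_forget (G_comonad hw sp)) Phi = bim_forget T C w.
Proof.
  exists (bim_to_comodule hw sp), (comodule_to_bim hw sp); split.
    exact: bim_to_comodule_inverse.
  (* The existential proofs are unified with those built into the functor. *)
  split; first by move=> X; do 2 eexists.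
  split; first by move=> Z; do 3 eexists.
  exact: forget_bim_to_comodule.
Qed.
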